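(* Let $R$ be a ring and let $M_{1}$, $M_{2}$ be $R$-modules. (1) If $M_{1}$ is a submodule of $M_{2}$ and $N$ is a gsdf-absorbing submodule of $M_{2}$ with $N\cap M_{1}\neq M_{1}$, then $N\cap M_{1}$ is a gsdf-absorbing submodule of $M_{1}$. (2) Let $K\subseteq N$ be proper submodules of $M_{1}$. Then $N$ is a gsdf-absorbing submodule of $M_{1}$ if and only if $N/K$ is a gsdf-absorbing submodule of $M_{1}/K$.
   Context: All rings are commutative with identity $1\neq 0$ and all modules are unital. Let $R$ be a ring and $M$ an $R$-module. A proper submodule $N$ of $M$ is called a generalized square-difference factor absorbing submodule (gsdf-absorbing submodule) if for all $u,v\in R$ and $x\in M$, the condition $(u^{2}-v^{2})x\in N$ implies that $(u-v)x\in N$ or $(u+v)^{k}x\in N$ for some integer $k\geq 1$. *)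

(* Defs.v *)
From HB Require Import structures.
From mathcomp Require Import all_boot all_order all_algebra.
From mathcomp Require Import boolp.

Set Implicit Arguments.
Unset Strict Implicit.
Unset Printing Implicit Defensive.

Import GRing.Theory.
Local Open Scope ring_scope.
Local Open Scope quotient_scope.

Definition proper_submodule (R : comNzRingType) (M : lmodType R)
    (N : {pred M}) : Prop :=
  submod_closed N /\ ~ (N =i predT).

Definition gsdf_absorbing (R : comNzRingType) (M : lmodType R)
    (N : {pred M}) : Prop :=
  proper_submodule N /\
  forall (u v : R) (x : M), (u ^+ 2 - v ^+ 2) *: x \in N ->
    (u - v) *: x \in N \/
    (exists2 k : nat, (1 <= k)%N & (u + v) ^+ k *: x \in N).

(* [M1] is the submodule of [M2] with underlying set [S] and inclusion map
   [\val], so this is the intersection of [N] and [M1] as a subset of [M1]. *)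
Definition submodule_cap (R : comNzRingType) (M2 : lmodType R)
    (S : {pred M2}) (M1 : subLmodType S) (N : {pred M2}) : {pred M1} :=
  [pred x : M1 | \val x \in N].
Arguments submodule_cap {R M2 S} M1 N.

(* MathComp provides the quotient of a zmodType by a zmodClosed predicate;
   the scalar action [a *: \pi x = \pi (a *: x)] is added here. *)
Section QuotientModule.
Variables (R : comNzRingType) (M : lmodType R) (K : submodClosed M).

Fact submod_oppr_closed : oppr_closed K.
Proof. by move=> x Kx; rewrite -scaleN1r rpredZ. Qed.

Definition submod_pred : {pred M} := K.

HB.instance Definition _ := GRing.SubmodClosed.on submod_pred.
HB.instance Definition _ :=
  GRing.isOppClosed.Build M submod_pred submod_oppr_closed.

Definition quotmod : Type := (Quotient.quot submod_pred).

HB.instance Definition _ := ZmodQuotient.on quotmod.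

Definition quotmod_scale (a : R) (q : quotmod) : quotmod :=
  \pi_quotmod (a *: repr q).

Fact eq_quotmodP (x y : M) :
  reflect (\pi_quotmod x = \pi_quotmod y) (x - y \in K).
Proof. by apply: (iffP idP); rewrite (Quotient.idealrBE submod_pred) => /eqP. Qed.

Fact quotmod_scale_pi (a : R) (x : M) :
  quotmod_scale a (\pi_quotmod x) = \pi_quotmod (a *: x).
Proof.
apply/eq_quotmodP; rewrite -scalerBr rpredZ //.
by apply/eq_quotmodP; rewrite reprK.
Qed.

Fact quotmod_piD (x y : M) :
  \pi_quotmod (x + y) = \pi_quotmod x + \pi_quotmod y.
Proof. exact: raddfD. Qed.

Fact quotmod_scaleA (a b : R) (q : quotmod) :
  quotmod_scale a (quotmod_scale b q) = quotmod_scale (a * b) q.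
Proof.
elim/quotW: q => x.
by rewrite (quotmod_scale_pi b x) !(quotmod_scale_pi _ _) scalerA.
Qed.

Fact quotmod_scale1 : left_id 1 quotmod_scale.
Proof. by elim/quotW=> x; rewrite (quotmod_scale_pi 1 x) scale1r. Qed.

Fact quotmod_scaleDr : right_distributive quotmod_scale +%R.
Proof.
move=> a; elim/quotW=> x; elim/quotW=> y.
rewrite -(quotmod_piD x y) (quotmod_scale_pi a x) (quotmod_scale_pi a y).
by rewrite (quotmod_scale_pi a (x + y)) scalerDr quotmod_piD.
Qed.

Fact quotmod_scaleDl (q : quotmod) :
  {morph quotmod_scale^~ q : a b / a + b}.
Proof.
elim/quotW: q => x a b.
rewrite (quotmod_scale_pi a x) (quotmod_scale_pi b x).
by rewrite (quotmod_scale_pi (a + b) x) scalerDl quotmod_piD.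
Qed.

HB.instance Definition _ := GRing.Zmodule_isLmodule.Build R quotmod
  quotmod_scaleA quotmod_scale1 quotmod_scaleDr quotmod_scaleDl.

Definition submodule_quot (N : {pred M}) : {pred quotmod} :=
  [pred q | `[< exists2 x : M, x \in N & q = \pi_quotmod x >]].

End QuotientModule.
Arguments submodule_quot {R M} K N.

(* Main.v *)
Require Import Defs.
From mathcomp Require Import all_boot all_order all_algebra.
From mathcomp Require Import boolp.
Set Implicit Arguments.
Unset Strict Implicit.
Unset Printing Implicit Defensive.
Import GRing.Theory.
Local Open Scope ring_scope.
Local Open Scope quotient_scope.

(** The absorbing condition only asks whether certain scalar multiples of one element lie in [N], so
    it transfers along a linear map for which the submodule upstairs is the full preimage of the one
    downstairs. For the inclusion of [M1] in [M2] this holds by definition. For the projection onto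
    the quotient it is [mem_submodule_quot], which rests on [K] lying in [N]; surjectivity of the
    projection then makes the transfer an equivalence. *)

Lemma gsdf_absorbing_cap (R : comNzRingType) (M2 : lmodType R) (S : {pred M2})
    (M1 : subLmodType S) (N : {pred M2}) :
  gsdf_absorbing N -> ~ ([predI N & S] =i S) ->
  gsdf_absorbing (submodule_cap M1 N).
Proof.
move=> [[[N0 NL] _] absN] NS; split; [split; [split|]|].
- by rewrite inE raddf0.
- by move=> a x y; rewrite !inE raddfD /= linearZ; apply: NL.
(* If the intersection were all of [M1], each [x] in [S], lifted to [M1] by [Sub], would lie in [N],
   contradicting [NS]. *)
- move=> NT; apply: NS => x; rewrite inE /=.
  case: (boolP (x \in S)) => [Sx|_]; last by rewrite andbF.
  by have := NT (Sub x Sx); rewrite !inE SubK => ->.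
- move=> u v x; rewrite inE linearZ => /absN [uvx|[k k1 uvx]].
    by left; rewrite inE linearZ.
  by right; exists k => //; rewrite inE linearZ.
Qed.

Section Quotient.
Variables (R : comNzRingType) (M : lmodType R).
Variables (K : submodClosed M) (N : {pred M}).
Hypotheses (Nsub : submod_closed N) (KN : {subset K <= N}).

(** A class in [N/K] has some representative [y] in [N]; any other representative [x] differs from
    it by an element of [K], hence of [N], so [x] is in [N] too. *)
Lemma mem_submodule_quot (x : M) :
  (\pi_(quotmod K) x \in submodule_quot K N) = (x \in N).
Proof.
rewrite inE; apply/asboolP/idP => [[y Ny /eq_quotmodP Kxy]|Nx]; last by exists x.
(* The coefficient 1 puts [(x - y) + y] in the shape [a *: u + v] of the closure axiom. *)
by rewrite -(subrK y x) -[x - y]scale1r; apply: Nsub.2 => //; apply: KN.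
Qed.

(** Used with [a] equal to [u ^+ 2 - v ^+ 2], [u - v] and [(u + v) ^+ k], this carries each clause
    of the absorbing condition across the projection. *)
Lemma mem_submodule_quotZ (a : R) (x : M) :
  (a *: \pi_(quotmod K) x \in submodule_quot K N) = (a *: x \in N).
Proof. by rewrite -mem_submodule_quot -quotmod_scale_pi. Qed.

Lemma submodule_quot_closed : submod_closed (submodule_quot K N).
Proof.
split.
- have -> : 0 = \pi_(quotmod K) 0 by rewrite raddf0.
  by rewrite mem_submodule_quot Nsub.1.
- move=> a; elim/quotW=> x; elim/quotW=> y.
  rewrite !mem_submodule_quot => Nx Ny.
  have -> : a *: \pi_(quotmod K) x + \pi_(quotmod K) y
            = \pi_(quotmod K) (a *: x + y).
    by rewrite quotmod_piD -quotmod_scale_pi.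
  by rewrite mem_submodule_quot; apply: Nsub.2.
Qed.

Lemma proper_submodule_quot :
  proper_submodule N <-> proper_submodule (submodule_quot K N).
Proof.
split=> -[_ NT]; split=> //; first exact: submodule_quot_closed.
- by move=> QT; apply: NT => x; rewrite -mem_submodule_quot QT.
- by move=> NT'; apply: NT; elim/quotW=> x; rewrite mem_submodule_quot NT'.
Qed.

Lemma gsdf_absorbing_quot :
  gsdf_absorbing N <-> gsdf_absorbing (submodule_quot K N).
Proof.
split=> -[/proper_submodule_quot properN absN]; split=> //.
(* Every element of the quotient is the class of some [x], so the condition on [N] at [x]
   suffices. *)
- move=> u v; elim/quotW=> x; rewrite !mem_submodule_quotZ.
  move=> /absN [|[k k1 uvx]]; first by left.
  by right; exists k; rewrite ?mem_submodule_quotZ.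
- move=> u v x; rewrite -!mem_submodule_quotZ.
  move=> /absN [|[k k1 uvx]]; first by left.
  by right; exists k; rewrite -?mem_submodule_quotZ.
Qed.

End Quotient.

Theorem corollary3p3 (R : comNzRingType) :
  (forall (M2 : lmodType R) (S : {pred M2}) (M1 : subLmodType S)
      (N : {pred M2}),
      gsdf_absorbing N ->
      ~ ([predI N & S] =i S) ->
      gsdf_absorbing (submodule_cap M1 N)) /\
  (forall (M1 : lmodType R) (K : submodClosed M1) (N : {pred M1}),
      proper_submodule K ->
      proper_submodule N ->
      {subset K <= N} ->
      (gsdf_absorbing N <-> gsdf_absorbing (submodule_quot K N))).
Proof.
split=> [M2 S M1 N|M1 K N _ [Nsub _] KN]; first exact: gsdf_absorbing_cap.
exact: gsdf_absorbing_quot.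
Qed.
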